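(* Let $C$ be a finite set of constants, let $M$ be an atomized semilattice over $C$, let $a,b$ be elements of $M$, and let $\Theta(x,y)$ denote the principal congruence of $M$ generated by $(x,y)$. Then: (i) $\square_{a\le b}M\cong M/\Theta(b,\,b\odot a)$; (ii) $M/\Theta(a,b)\cong\square_{a\le b}\,\square_{b\le a}M$.
   Context: A semilattice is a nonempty set with a commutative, associative, idempotent binary operation $\odot$, ordered by $a\le b$ iff $a\odot b=b$. For a finite set $C$ of constants, $F_C(\emptyset)$ is the free semilattice on $C$; its elements (terms) $t$ are identified with their nonempty sets $\mathbf{C}(t)\subseteq C$ of component constants, with $\odot$ acting as union. A semilattice model over $C$ is a semilattice $M$ with a map $C\to M$ whose image generates $M$; it induces the natural homomorphism $\nu_M:F_C(\emptyset)\to M$. The principal congruence $\Theta(x,y)$ is the smallest congruence of $M$ with $x$ and $y$ in the same class. An atom $\phi$ over $C$ is determined by a nonempty subset $\mathbf{U}^c(\phi)\subseteq C$; for a term $t$, $\phi<t$ means $\mathbf{C}(t)\cap\mathbf{U}^c(\phi)\ne\emptyset$. A set $A$ of atoms over $C$ atomizes $M$ if every $c\in C$ satisfies $\phi<c$ for some $\phi\in A$, and for all terms $t,s$: $\nu_M(t)\le\nu_M(s)$ iff there is no $\phi\in A$ with $\phi<t$ and $\phi\not<s$. An atomized semilattice over $C$ is a model over $C$ together with a set of atoms atomizing it. The union $\phi\bigtriangledown\psi$ is the atom with $\mathbf{U}^c(\phi\bigtriangledown\psi)=\mathbf{U}^c(\phi)\cup\mathbf{U}^c(\psi)$. Full crossing: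 for terms $r_L,r_R$ over $C$ and $M$ atomized by $A$, put $H=\{\phi\in A:\phi<r_L,\ \phi\not<r_R\}$ and $B=\{\phi\in A:\phi<r_R\}$; then $\square_{r_L\le r_R}M$ is the model over $C$ atomized by $(A\setminus H)\cup\{\lambda\bigtriangledown\rho:\lambda\in H,\ \rho\in B\}$. For elements $a,b$ of $M$, choose terms over $C$ representing $a$ and $b$, and use these terms in $\square_{a\le b}$ and $\square_{b\le a}$ (also when crossing in $\square_{b\le a}M$). *)

(* Defs.v *)
From HB Require Import structures.
From mathcomp Require Import all_boot all_order.
From mathcomp Require Import generic_quotient boolp.

Set Implicit Arguments.
Unset Strict Implicit.
Unset Printing Implicit Defensive.

Import Order.TTheory.
Local Open Scope order_scope.
Local Open Scope quotient_scope.

(* A semilattice is a [joinSemilatticeType]: its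
   operation is [x `|` y], and [x <= y] iff [x `|` y = y].  The factory below
   builds one from a commutative, associative, idempotent operation. *)

HB.factory Record isOpSemilattice (d : Order.disp_t) T of Choice T := {
  op : T -> T -> T;
  opC : commutative op;
  opA : associative op;
  opI : idempotent_op op;
}.

HB.builders Context d T of isOpSemilattice d T.

Let le x y := op x y == y.

Fact le_refl : reflexive le.
Proof. by move=> x; rewrite /le opI. Qed.

Fact le_anti : antisymmetric le.
Proof. by move=> x y /andP[/eqP lxy /eqP lyx]; rewrite -lxy opC lyx. Qed.

Fact le_trans : transitive le.
Proof.
by move=> y x z /eqP lxy /eqP lyz; apply/eqP; rewrite -lyz opA lxy.
Qed.

HB.instance Definition _ := Order.Le_isPOrder.Build d T le_refl le_anti le_trans.

Fact leEop (x y : T) : (y <= x) = (op x y == x).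
Proof. by rewrite opC. Qed.

HB.instance Definition _ := Order.POrder_Join_isSemilattice.Build d T opC opA leEop.

HB.end.

Section Terms.
Variable C : finType.

(* Elements of the free semilattice on [C]. *)
Record term := Term { consts :> {set C}; consts_neq0 : consts != set0 }.

HB.instance Definition _ := [isSub for consts].
HB.instance Definition _ := [Finite of term by <:].

Fact const_term_subproof (c : C) : [set c] != set0.
Proof. by rewrite -card_gt0 cards1. Qed.

Definition const_term (c : C) : term := Term (const_term_subproof c).

Fact term_op_subproof (t s : term) : consts t :|: consts s != set0.
Proof. by rewrite setU_eq0 negb_and consts_neq0. Qed.

Definition term_op (t s : term) := Term (term_op_subproof t s).

Fact term_opC : commutative term_op.
Proof. by move=> t s; apply: val_inj; rewrite /= setUC. Qed.

Fact term_opA : associative term_op.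
Proof. by move=> t s u; apply: val_inj; rewrite /= setUA. Qed.

Fact term_opI : idempotent_op term_op.
Proof. by move=> t; apply: val_inj; rewrite /= setUid. Qed.

Fact term_display : Order.disp_t. Proof. exact: Order.Disp tt tt. Qed.

HB.instance Definition _ :=
  isOpSemilattice.Build term_display term term_opC term_opA term_opI.

Lemma consts_join (t s : term) : consts (t `|` s) = consts t :|: consts s.
Proof. by []. Qed.

Lemma term_ind (P : term -> Prop) :
    (forall c, P (const_term c)) ->
    (forall t s, P t -> P s -> P (t `|` s)) ->
  forall t, P t.
Proof.
move=> Pc PU t; have [n] := ubnP #|consts t|; elim: n t => // n IHn t ltn.
have [c ct] := set0Pn _ (consts_neq0 t).
have [t0|tn0] := eqVneq (consts t :\ c) set0.
  have -> : t = const_term c.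
    by apply: val_inj; rewrite /= -(setD1K ct) t0 setU0.
  exact: Pc.
have -> : t = const_term c `|` Term tn0.
  by apply: val_inj; rewrite /= setD1K.
apply: PU; first exact: Pc.
apply: IHn => /=; rewrite ltnS in ltn; apply: leq_trans ltn.
by rewrite [X in (_ < X)%N](cardsD1 c) ct.
Qed.

End Terms.

Record model (C : finType) := Model {
  model_disp : Order.disp_t;
  carrier :> joinSemilatticeType model_disp;
  const : C -> carrier;
  model_nonempty : inhabited carrier;
  model_gen : forall P : carrier -> Prop,
    (forall c, P (const c)) ->
    (forall x y, P x -> P y -> P (x `|` y)) ->
    forall x, P x
}.
Arguments const {C} m c.

Lemma model_const (C : finType) (M : model C) : inhabited C.
Proof.
have [x] := model_nonempty M.
by elim/(@model_gen C M): x => // c; exists.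
Qed.

Definition free_model (C : finType) (c0 : inhabited C) : model C :=
  @Model C _ (term C) (@const_term C)
    (let: inhabits c := c0 in inhabits (const_term c)) (@term_ind C).

Section NaturalHom.
Variables (C : finType) (M : model C).

(* As there is no bottom element, the join over the component constants starts
   from one of them; the result does not depend on which, by idempotency. *)
Definition nu (t : term C) : M :=
  \big[Order.join/const M (xchoose (set0Pn _ (consts_neq0 t)))]_(c in consts t)
     const M c.

Lemma nu_le (t : term C) (z : M) :
  (nu t <= z) = [forall c in consts t, const M c <= z].
Proof.
rewrite /nu; set c0 := xchoose _.
have c0t : c0 \in consts t by apply: xchooseP.
have bigle (r : seq C) : (\big[Order.join/const M c0]_(c <- r | c \in consts t)
     const M c <= z) =
    (const M c0 <= z) && all (fun c => (c \in consts t) ==> (const M c <= z)) r.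
  elim: r => [|c r IHr] /=; first by rewrite big_nil andbT.
  rewrite big_cons; case: ifP => _ /=; last exact: IHr.
  by rewrite leUx IHr andbCA.
rewrite bigle; apply/andP/forallP => [[_ /allP le_z] c|le_z].
  by apply: le_z; rewrite mem_index_enum.
split; last by apply/allP => c _; apply: le_z.
exact: (implyP (le_z c0)).
Qed.

Lemma nu_const (c : C) : nu (const_term c) = const M c.
Proof.
apply/eqP; rewrite eq_le nu_le; apply/andP; split.
  by apply/forall_inP => c' /set1P ->.
have : nu (const_term c) <= nu (const_term c) by [].
by rewrite nu_le => /forall_inP; apply; apply: set11.
Qed.

Lemma nu_join : {morph nu : t s / t `|` s}.
Proof.
move=> t s.
have leE z : (nu (t `|` s) <= z) = (nu t `|` nu s <= z).
  rewrite leUx !nu_le consts_join; apply/forall_inP/andP.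
    by move=> le_z; split; apply/forall_inP => c ct; apply: le_z;
      rewrite inE ct ?orbT.
  by move=> [/forall_inP let_ /forall_inP les] c /setUP[/let_|/les].
by apply/eqP; rewrite eq_le leE lexx -leE lexx.
Qed.

Lemma nu_unique (f : term C -> M) :
    {morph f : t s / t `|` s} -> (forall c, f (const_term c) = const M c) ->
  f =1 nu.
Proof.
move=> fU fc; elim/term_ind => [c|t s IHt IHs]; first by rewrite fc nu_const.
by rewrite fU nu_join IHt IHs.
Qed.

End NaturalHom.

Record congruence d (L : joinSemilatticeType d) := Congruence {
  cong :> L -> L -> Prop;
  cong_refl : forall x, cong x x;
  cong_sym : forall x y, cong x y -> cong y x;
  cong_trans : forall x y z, cong x y -> cong y z -> cong x z;
  cong_join : forall x y u v,
    cong x y -> cong u v -> cong (x `|` u) (y `|` v)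
}.

Section Principal.
Context {d : Order.disp_t} {L : joinSemilatticeType d} (x y : L).

Definition Theta_rel (u v : L) : Prop :=
  forall R : congruence L, R x y -> R u v.

Fact Theta_refl u : Theta_rel u u.
Proof. by move=> R _; apply: cong_refl. Qed.

Fact Theta_sym u v : Theta_rel u v -> Theta_rel v u.
Proof. by move=> uv R xy; apply: cong_sym; apply: uv. Qed.

Fact Theta_trans u v w :
  Theta_rel u v -> Theta_rel v w -> Theta_rel u w.
Proof. by move=> uv vw R xy; apply: cong_trans (uv R xy) (vw R xy). Qed.

Fact Theta_join u v u' v' : Theta_rel u v -> Theta_rel u' v' ->
  Theta_rel (u `|` u') (v `|` v').
Proof. by move=> uv uv' R xy; apply: cong_join; [apply: uv | apply: uv']. Qed.

Definition Theta : congruence L :=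
  Congruence Theta_refl Theta_sym Theta_trans Theta_join.

End Principal.

Section Quotient.
Context {d : Order.disp_t} {L : joinSemilatticeType d} (R : congruence L).

Definition congb : rel L := fun x y => `[< R x y >].

Fact congb_refl : reflexive congb.
Proof. by move=> x; apply/asboolP; apply: cong_refl. Qed.

Fact congb_sym : symmetric congb.
Proof. by move=> x y; apply/asboolP/asboolP; apply: cong_sym. Qed.

Fact congb_trans : transitive congb.
Proof.
move=> y x z /asboolP xy /asboolP yz.
by apply/asboolP; apply: cong_trans xy yz.
Qed.

Canonical congb_equiv := EquivRel congb congb_refl congb_sym congb_trans.

Definition quot := {eq_quot congb_equiv}.
HB.instance Definition _ := Choice.on quot.
HB.instance Definition _ := EqQuotient.on quot.

Lemma quot_eqP (x y : L) : (\pi_quot x = \pi_quot y) <-> R x y.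
Proof.
split=> [/eqquotP|xy]; first by move=> /asboolP.
by apply/eqquotP; apply/asboolP.
Qed.

Definition quot_op (u v : quot) : quot := \pi_quot (repr u `|` repr v).

Lemma pi_quot_op (x y : L) :
  \pi_quot (x `|` y) = quot_op (\pi_quot x) (\pi_quot y).
Proof.
by apply/quot_eqP; apply: cong_join; apply/quot_eqP; rewrite reprK.
Qed.

Fact quot_opC : commutative quot_op.
Proof. by move=> u v; rewrite /quot_op joinC. Qed.

Fact quot_opA : associative quot_op.
Proof.
move=> u v w; rewrite -[u]reprK -[v]reprK -[w]reprK.
rewrite -(pi_quot_op (repr v)) -(pi_quot_op (repr u) (_ `|` _)).
by rewrite -(pi_quot_op (repr u)) -(pi_quot_op (_ `|` _)) joinA.
Qed.

Fact quot_opI : idempotent_op quot_op.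
Proof. by move=> u; rewrite -[u]reprK -(pi_quot_op (repr u)) joinxx. Qed.

HB.instance Definition _ :=
  isOpSemilattice.Build d quot quot_opC quot_opA quot_opI.

Lemma pi_join : {morph \pi_quot : x y / x `|` y}.
Proof. exact: pi_quot_op. Qed.

End Quotient.

Section QuotientModel.
Variables (C : finType) (M : model C) (R : congruence M).

Definition quot_const (c : C) : quot R := \pi_(quot R) (const M c).

Fact quot_nonempty : inhabited (quot R).
Proof. by have [x] := model_nonempty M; exists; apply: (\pi_(quot R) x). Qed.

Fact quot_gen (P : quot R -> Prop) :
    (forall c, P (quot_const c)) ->
    (forall x y, P x -> P y -> P (x `|` y)) ->
  forall x, P x.
Proof.
move=> Pc PU x; rewrite -[x]reprK.
elim/(@model_gen C M): (repr x) => [c|u v Pu Pv]; first exact: Pc.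
by rewrite pi_join; apply: PU.
Qed.

Definition quot_model : model C := Model quot_nonempty quot_gen.

Lemma nu_quot (t : term C) : nu quot_model t = \pi_(quot R) (nu M t).
Proof.
symmetry; apply: (@nu_unique C quot_model (fun s => \pi_(quot R) (nu M s))).
  by move=> s u; rewrite nu_join pi_join.
by move=> c; rewrite nu_const.
Qed.

End QuotientModel.

Section Atoms.
Variable C : finType.

Record atom := Atom { Uc : {set C}; Uc_neq0 : Uc != set0 }.

HB.instance Definition _ := [isSub for Uc].
HB.instance Definition _ := [Finite of atom by <:].

Definition atom_below (phi : atom) (t : term C) : bool :=
  consts t :&: Uc phi != set0.

Fact atom_union_subproof (phi psi : atom) : Uc phi :|: Uc psi != set0.
Proof. by rewrite setU_eq0 negb_and Uc_neq0. Qed.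

Definition atom_union (phi psi : atom) : atom :=
  Atom (atom_union_subproof phi psi).

Definition covers (A : {set atom}) : Prop :=
  forall c : C, exists2 phi, phi \in A & atom_below phi (const_term c).

Definition atomizes (A : {set atom}) (M : model C) : Prop :=
  covers A /\
  forall t s : term C, nu M t <= nu M s <->
    ~ exists2 phi, phi \in A & atom_below phi t && ~~ atom_below phi s.

Lemma atom_below_const phi c : atom_below phi (const_term c) = (c \in Uc phi).
Proof.
apply/set0Pn/idP => [[x /setIP[/set1P -> //]]|cU].
by exists c; rewrite inE set11.
Qed.

Lemma atom_below_join phi (t s : term C) :
  atom_below phi (t `|` s) = atom_below phi t || atom_below phi s.
Proof. by rewrite /atom_below consts_join setIUl setU_eq0 negb_and. Qed.

Lemma atom_below_union phi psi (t : term C) :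
  atom_below (atom_union phi psi) t = atom_below phi t || atom_below psi t.
Proof. by rewrite /atom_below /= setIUr setU_eq0 negb_and. Qed.

End Atoms.

Notation "phi '\bigtriangledown' psi" := (atom_union phi psi) (at level 50).

Record atomized (C : finType) := Atomized {
  atomized_model :> model C;
  atoms_of : {set atom C};
  atomizesP : atomizes atoms_of atomized_model
}.

(* The model atomized by [A] is the quotient of the free semilattice which
   identifies the terms that have the same atoms of [A] below them. *)
Section ModelOfAtoms.
Variables (C : finType) (c0 : inhabited C) (A : {set atom C}).

Definition same_atoms (t s : term C) : Prop :=
  forall phi, phi \in A -> atom_below phi t = atom_below phi s.

Fact same_atoms_refl t : same_atoms t t.
Proof. by []. Qed.

Fact same_atoms_sym t s : same_atoms t s -> same_atoms s t.
Proof. by move=> ts phi /ts. Qed.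

Fact same_atoms_trans t s u :
  same_atoms t s -> same_atoms s u -> same_atoms t u.
Proof. by move=> ts su phi pA; rewrite ts // su. Qed.

Fact same_atoms_join t s t' s' : same_atoms t s -> same_atoms t' s' ->
  same_atoms (t `|` t') (s `|` s').
Proof.
by move=> ts ts' phi pA; rewrite !atom_below_join ts // ts'.
Qed.

Definition atoms_cong : congruence (free_model c0) :=
  @Congruence _ (free_model c0) same_atoms same_atoms_refl same_atoms_sym
    same_atoms_trans same_atoms_join.

Definition model_of_atoms : model C := quot_model atoms_cong.

Fact model_of_atomsP : covers A -> atomizes A model_of_atoms.
Proof.
move=> covA; split=> // t s.
have nuE u : nu model_of_atoms u = \pi_(quot atoms_cong) u.
  rewrite nu_quot; congr (\pi _); symmetry.
  by apply: (@nu_unique C (free_model c0) id).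
rewrite leEjoin joinC !nuE -pi_join; split.
  move=> /eqP/quot_eqP ts [phi pA /andP[pt /negP]]; apply.
  by have := ts phi pA; rewrite atom_below_join pt orbT => <-.
move=> nts; apply/eqP/quot_eqP => phi pA; rewrite atom_below_join orbC.
apply: orb_idl => pt; apply: contraT => ps; case: nts; exists phi => //.
by rewrite [X in X && _]pt.
Qed.

Definition atomized_of (covA : covers A) : atomized C :=
  Atomized (model_of_atomsP covA).

End ModelOfAtoms.

Section FullCrossing.
Variables (C : finType) (rL rR : term C).

Definition crossing_H (A : {set atom C}) : {set atom C} :=
  [set phi in A | atom_below phi rL && ~~ atom_below phi rR].

Definition crossing_B (A : {set atom C}) : {set atom C} :=
  [set phi in A | atom_below phi rR].

Definition crossing_atoms (A : {set atom C}) : {set atom C} :=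
  (A :\: crossing_H A) :|:
  [set lambda \bigtriangledown rho |
     lambda in crossing_H A, rho in crossing_B A].

Fact crossing_covers (A : {set atom C}) :
  covers A -> covers (crossing_atoms A).
Proof.
move=> covA c; have [phi pA pc] := covA c.
have [pH|pnH] := boolP (phi \in crossing_H A); last first.
  by exists phi => //; apply/setUP; left; apply/setDP.
have [e eR] := set0Pn _ (consts_neq0 rR).
have [rho rA re] := covA e.
exists (phi \bigtriangledown rho); last by rewrite atom_below_union pc.
apply/setUP; right; apply/imset2P; exists phi rho => //.
rewrite inE rA; apply/set0Pn; exists e; rewrite inE eR.
by rewrite -atom_below_const.
Qed.

Definition full_crossing (M : atomized C) : atomized C :=
  atomized_of (model_const M) (crossing_covers (proj1 (atomizesP M))).

End FullCrossing.

(* Isomorphism of models over [C]: it also preserves the constants. *)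
Definition model_iso (C : finType) (M N : model C) : Prop :=
  exists f : M -> N,
    [/\ bijective f,
        {morph f : x y / x `|` y} &
        forall c, f (const M c) = const N c].

(* Main.v *)
Require Import Defs.
From mathcomp Require Import all_boot all_order.

Local Open Scope order_scope.

(** Models over [C] are preordered by the existence of a homomorphism fixing
    the constants, equivalently by inclusion of the term inequalities they
    satisfy; models that are equivalent for this preorder are isomorphic.  Both
    operations are universal for it: [full_crossing rL rR M] maps to [K] iff [M]
    maps to [K] and [rL <= rR] holds in [K], while the quotient of [M] by
    [Theta x y] maps to [K] iff [M] maps to [K] and [x = y] holds in [K].  The
    isomorphisms follow because [a <= b] is equivalent to [b = b `|` a], and
    [a = b] to [a <= b] together with [b <= a]. *)

Import Order.TTheory.

Definition model_maps {C : finType} (M K : model C) : Prop :=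
  forall t s : term C, nu M t <= nu M s -> nu K t <= nu K s.

Section ModelMaps.
Variable C : finType.
Implicit Types (M K L : model C) (t s : term C).

Lemma model_maps_refl M : model_maps M M.
Proof. by []. Qed.

Lemma model_maps_trans M K L :
  model_maps M K -> model_maps K L -> model_maps M L.
Proof. by move=> MK KL t s /MK/KL. Qed.

Lemma model_maps_eq M K t s :
  model_maps M K -> nu M t = nu M s -> nu K t = nu K s.
Proof. by move=> MK ts; apply/le_anti; rewrite !MK ?ts. Qed.

Lemma nu_surj M (x : M) : exists t, nu M t == x.
Proof.
elim/(@model_gen C M): x => [c|x y [t /eqP tx] [s /eqP sy]].
  by exists (const_term c); rewrite nu_const.
by exists (t `|` s); rewrite nu_join tx sy.
Qed.

(** Sending an element of [M] to the value in [K] of a term representing it does not depend on the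
    term, by [model_maps_eq]. *)
Lemma model_maps_hom M K : model_maps M K ->
  exists2 f : M -> K, {morph f : x y / x `|` y} & forall t, f (nu M t) = nu K t.
Proof.
move=> MK; pose f x := nu K (xchoose (nu_surj M x)).
have fnu t : f (nu M t) = nu K t.
  by apply: model_maps_eq MK _; apply/eqP; exact: (xchooseP (nu_surj M _)).
exists f => // x y.
have [t /eqP <-] := nu_surj M x; have [s /eqP <-] := nu_surj M y.
by rewrite -nu_join !fnu nu_join.
Qed.

Lemma model_maps_iso M K : model_maps M K -> model_maps K M -> model_iso M K.
Proof.
move=> /model_maps_hom[f fU fnu] /model_maps_hom[g _ gnu].
exists f; split=> // [|c]; last by rewrite -!nu_const.
exists g => x.
  by have [t /eqP <-] := nu_surj M x; rewrite fnu gnu.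
by have [t /eqP <-] := nu_surj K x; rewrite gnu fnu.
Qed.

Lemma quot_Theta_maps M K t s :
  model_maps (quot_model (Theta (nu M t) (nu M s))) K <->
  model_maps M K /\ nu K t = nu K s.
Proof.
set Q := quot_model _; split=> [QK|[/model_maps_hom[f fU fnu] Kts]].
  split; last first.
    apply: model_maps_eq QK _; rewrite !nu_quot.
    by apply/quot_eqP => R; apply.
  apply: model_maps_trans QK => u v uv.
  move: uv; rewrite !leEjoin !nu_quot -pi_join.
  by move=> /eqP ->.
(* The kernel of [f] is a congruence containing the generating pair, hence it contains [Theta]. *)
pose kerf := @Congruence _ M (fun x y => f x = f y) (fun=> erefl)
  (fun x y => @esym _ (f x) (f y)) (fun x y z => @etrans _ (f x) (f y) (f z))
  (fun x y u v xy uv => etrans (fU x u)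
     (etrans (congr2 _ xy uv) (esym (fU y v)))).
move=> u v; rewrite leEjoin !nu_quot -pi_join.
move=> /eqP/quot_eqP/(_ kerf); rewrite /= fU !fnu => /(_ Kts) uv.
by rewrite leEjoin uv.
Qed.

(** An atom of [crossing_H] that separates [t] from [s] is replaced by its unions with the atoms of
    [crossing_B]; some union still separates unless all of [crossing_B] is below [s], that is,
    [rR <= s]. In that case no union separates, and a kept atom not below [s] is not below [rR],
    hence not below [rL]. *)
Lemma full_crossing_le (M : atomized C) (rL rR t s : term C) :
  nu (full_crossing rL rR M) t <= nu (full_crossing rL rR M) s <->
  nu M t <= nu M s \/ nu M rR <= nu M s /\ nu M t <= nu M (s `|` rL).
Proof.
have [_ leM] := atomizesP M; have [_ leN] := atomizesP (full_crossing rL rR M).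
rewrite leN !leM {leN leM} /=; set A := atoms_of M; split=> [nN|].
  have [/exists_inP[rho rA /andP[rR_ rs]]|/exists_inP nB] :=
    boolP [exists rho in A, atom_below rho rR && ~~ atom_below rho s].
    left=> -[phi pA /andP[pt ps]]; apply: nN.
    have [pH|pH] := boolP (phi \in crossing_H rL rR A); last first.
      by exists phi; rewrite ?pt // in_setU in_setD pH pA.
    exists (phi \bigtriangledown rho).
      by apply/setUP; right; apply/imset2P; exists phi rho; rewrite // inE rA.
    by rewrite !atom_below_union pt negb_or ps rs.
  right; split=> // -[phi pA]; rewrite atom_below_join negb_or.
  case/and3P=> pt ps pL; apply: nN; exists phi; rewrite ?pt //.
  by rewrite !inE pA (negPf pL) andbF.
case=> [nM|[nR nM]] [phi] /setUP[].
- by move=> /setDP[pA _] pts; apply: nM; exists phi.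
- move=> /imset2P[la rho]; rewrite !inE => /andP[lA _] /andP[rA _] ->.
  (* Whichever component is below [t] separates [t] from [s] by itself. *)
  rewrite !atom_below_union negb_or => /and3P[/orP[lt|rt] ls rs]; apply: nM.
    by exists la; rewrite ?lt.
  by exists rho; rewrite ?rt.
- move=> /setDP[pA]; rewrite inE pA /= negb_and negbK => pH /andP[pt ps].
  have pR : ~~ atom_below phi rR.
    by apply/negP => pR; apply: nR; exists phi; rewrite ?pR.
  apply: nM; exists phi => //; rewrite pt atom_below_join negb_or ps.
  by rewrite (negPf pR) orbF in pH.
- move=> /imset2P[la rho _]; rewrite inE => /andP[rA rR_] ->.
  rewrite !atom_below_union negb_or => /and3P[_ _ rs].
  by apply: nR; exists rho; rewrite ?rR_.
Qed.

Lemma full_crossing_maps (M : atomized C) K (rL rR : term C) :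
  model_maps (full_crossing rL rR M) K <->
  model_maps M K /\ nu K rL <= nu K rR.
Proof.
split=> [NK|[MK KLR] t s /full_crossing_le[/MK //|[/MK Rs /MK]]].
  split=> [t s ts|]; apply: NK; apply/full_crossing_le; first by left.
  (* The second alternative is used with [t := rL] and [s := rR]. *)
  by right; rewrite nu_join leUr.
(* In [K], [rL <= rR <= s], so the join of [s] and [rL] is below [s]. *)
move=> /le_trans; apply; rewrite nu_join leUx lexx.
exact: le_trans KLR Rs.
Qed.

End ModelMaps.

Theorem theorem29 (C : finType) (M : atomized C) (a b : M) (ta tb : term C)
    (ha : nu M ta = a) (hb : nu M tb = b) :
  model_iso (full_crossing ta tb M) (quot_model (Theta b (b `|` a))) /\
  model_iso (quot_model (Theta a b))
    (full_crossing ta tb (full_crossing tb ta M)).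
Proof.
rewrite -ha -hb -nu_join; split; apply: model_maps_iso.
(* In each of the four directions, the universal property of the target, applied to its identity
   map, yields the conditions for mapping the source into it. *)
- have [MQ Q] := (quot_Theta_maps C M _ tb (tb `|` ta)).1 (model_maps_refl _ _).
  apply/full_crossing_maps; split; first exact: MQ.
  by rewrite Q (nu_join (quot_model _)) leUr.
- have [MN N] := (full_crossing_maps C M _ ta tb).1 (model_maps_refl _ _).
  apply/quot_Theta_maps; split; first exact: MN.
  by rewrite nu_join joinC; move: N; rewrite leEjoin => /eqP ->.
- pose N := full_crossing tb ta M.
  have [NK ab] := (full_crossing_maps C N _ ta tb).1 (model_maps_refl _ _).
  have [MK ba] := (full_crossing_maps C M _ tb ta).1 NK.
  by apply/quot_Theta_maps; split; [exact: MK | apply/le_anti; rewrite ab ba].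
- have [MQ Q] := (quot_Theta_maps C M _ ta tb).1 (model_maps_refl _ _).
  apply/full_crossing_maps; rewrite Q; split=> //.
  by apply/full_crossing_maps; rewrite Q; split.
Qed.
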